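(* Let $p=(p_k)_{k=0}^{K}$ be the strictly positive solution, of regularity $p_k(\cdot,\cdot,o_{1:k})\in C^{1,2}([t_k,t_{k+1}]\times\mathbb{R}^d;\mathbb{R})$ for all $k=0,\dots,K-1$ and $o_{1:k}\in\mathbb{O}_k$, of the unnormalized filtering equations: $p_0(0,x)=\pi_0(x)$ for $x\in\mathbb{R}^d$ and, for $k=0,\dots,K-1$, $x\in\mathbb{R}^d$, $o_{1:k+1}\in\mathbb{O}_{k+1}$ (with $o_{1:k}$ denoting its first $k$ entries) and $t\in[t_k,t_{k+1}]$, $$p_k(t,x,o_{1:k})=p_k(t_k,x,o_{1:k})+\int_{t_k}^{t}\Big(A p_k(s,x,o_{1:k})+f\big(x,p_k(s,x,o_{1:k}),\nabla p_k(s,x,o_{1:k})\big)\Big)\,\mathrm{d}s,$$ $$p_{k+1}(t_{k+1},x,o_{1:k+1})=p_k(t_{k+1},x,o_{1:k})\,L(o_{k+1},x).$$ Define $v=(v_k)_{k=0}^K$ by $v_k=-\log p_k$ for $k=0,\dots,K$, that is, $v_k(t,x,o_{1:k})=-\log p_k(t,x,o_{1:k})$ wherever $p_k$ is defined. Then $v_0(0,x)=-\log(\pi_0(x))$ for $x\in\mathbb{R}^d$, and $v$ solves the following equations: for all $k=0,\dots,K-1$, $x\in\mathbb{R}^d$, $o_{1:k+1}\in\mathbb{O}_{k+1}$ and $t\in[t_k,t_{k+1}]$, $$v_k(t,x,o_{1:k})=v_k(t_k,x,o_{1:k})+\int_{t_k}^{t}\Big(A v_k(s,x,o_{1:k})+f_{\mathrm{log}}\big(x,v_k(s,x,o_{1:k}),\nabla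 v_k(s,x,o_{1:k})\big)\Big)\,\mathrm{d}s,$$ $$v_{k+1}(t_{k+1},x,o_{1:k+1})=v_k(t_{k+1},x,o_{1:k})-\log\big(L(o_{k+1},x)\big),$$ where, for $x\in\mathbb{R}^d$, $u\in\mathbb{R}$ and $w\in\mathbb{R}^d$, $$f_{\mathrm{log}}(x,u,w)=-\frac{1}{2}\big\|\sigma(x)^\top w\big\|^2-f(x,1,-w).$$
   Context: Let $d,d',K\in\mathbb{N}$, $T>0$ and $t_k=kT/K$ for $k=0,\dots,K$. Write $\mathbb{O}_k=\mathbb{R}^{d'\times k}$ for the space of observation sequences $o_{1:k}=(o_1,\dots,o_k)$, $o_i\in\mathbb{R}^{d'}$; for $k=0$ the sequence is empty and the argument $o_{1:0}$ is dropped. $\|\cdot\|$ is the Euclidean norm, and $\nabla$ and the operator $A$ act in the space variable $x$. $C^{1,2}([s,t]\times\mathbb{R}^d;\mathbb{R})$ denotes the real-valued functions that are once continuously differentiable in time and twice continuously differentiable in space. The coefficients $\mu:\mathbb{R}^d\to\mathbb{R}^d$ and $\sigma:\mathbb{R}^d\to\mathbb{R}^{d\times d}$ (drift and diffusion of the signal SDE $\mathrm{d}S_t=\mu(S_t)\,\mathrm{d}t+\sigma(S_t)\,\mathrm{d}B_t$, $S_0\sim\pi_0$) are sufficiently regular; in particular $\mu$ is $C^1$ and $a=(a_{ij}):=\sigma\sigma^\top$ is $C^2$. The function $\pi_0:\mathbb{R}^d\to(0,\infty)$ is the initial probability density. The measurement function is $h:\mathbb{R}^d\to\mathbb{R}^{d'}$,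 and $L(o,x)=\mathcal{N}(o\mid h(x),R)$ is the likelihood, i.e. the Gaussian density on $\mathbb{R}^{d'}$ with mean $h(x)$ and (positive definite) covariance matrix $R\in\mathbb{R}^{d'\times d'}$, evaluated at $o$. The infinitesimal generator $A$ acts on $\varphi\in C^2(\mathbb{R}^d;\mathbb{R})$ by $$A\varphi=\frac12\sum_{i,j=1}^d a_{ij}\frac{\partial^2\varphi}{\partial x_i\partial x_j}+\sum_{i=1}^d\mu_i\frac{\partial\varphi}{\partial x_i},$$ and $f:\mathbb{R}^d\times\mathbb{R}\times\mathbb{R}^d\to\mathbb{R}$ is defined by $$f(x,u,w)=\sum_{i,j=1}^d\frac{\partial a_{ij}(x)}{\partial x_i}\,w_j+\frac12\sum_{i,j=1}^d\frac{\partial^2a_{ij}(x)}{\partial x_i\partial x_j}\,u-\sum_{i=1}^d\frac{\partial\mu_i(x)}{\partial x_i}\,u-2\sum_{i=1}^d\mu_i(x)\,w_i ,$$ so that $A\varphi(x)+f(x,\varphi(x),\nabla\varphi(x))=(A^*\varphi)(x)$ with $A^*\varphi=\frac12\sum_{i,j}\frac{\partial^2}{\partial x_i\partial x_j}(a_{ij}\varphi)-\sum_i\frac{\partial}{\partial x_i}(\mu_i\varphi)$ the formal adjoint of $A$. For $k=0,\dots,K-1$, $p_k$ and $v_k$ are functions on $[t_k,t_{k+1}]\times\mathbb{R}^d\times\mathbb{O}_k$; for $k=K$ they are defined only at time $t_K=T$, through the update equation. *)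

(* Defs.v *)
From HB Require Import structures.
From mathcomp Require Import all_boot all_order all_algebra.
From mathcomp Require Import all_classical all_reals all_analysis.

Set Implicit Arguments.
Unset Strict Implicit.
Unset Printing Implicit Defensive.

Import Order.TTheory GRing.Theory Num.Theory.
Import numFieldNormedType.Exports.

Local Open Scope classical_set_scope.
Local Open Scope ring_scope.

Section Calculus.
Context {R : realType} {d : nat}.
Implicit Types (phi : 'cV[R]_d -> R) (x : 'cV[R]_d).

Definition partial (i : 'I_d) phi x : R := 'D_(delta_mx i 0) phi x.

Definition grad phi x : 'cV[R]_d := \col_i partial i phi x.

Definition C1 phi : Prop :=
  continuous phi /\
  forall i, (forall x, derivable phi x (delta_mx i 0)) /\
            continuous (partial i phi).

Definition C2 phi : Prop := C1 phi /\ forall i, C1 (partial i phi).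

(* C^{1,2}([s, t] x R^d).  The time derivative is the limit of difference
   quotients taken inside [s, t], hence one-sided at the end points; all
   continuity requirements are joint in time and space. *)
Definition C12 (s t : R) (u : R -> 'cV[R]_d -> R) : Prop :=
  let Q : set (R * 'cV[R]_d) := `[s, t]%classic `*` [set: 'cV[R]_d] in
  [/\ {within Q, continuous (fun z => u z.1 z.2)},
      exists2 ut : R * 'cV[R]_d -> R,
        {within Q, continuous ut} &
        forall r x, r \in `[s, t] ->
          (fun q => (u q x - u r x) / (q - r))
            @ within `[s, t]%classic (r^') --> ut (r, x),
      forall i,
        (forall r x, r \in `[s, t] -> derivable (u r) x (delta_mx i 0)) /\
        {within Q, continuous (fun z => partial i (u z.1) z.2)} &
      forall i j,
        (forall r x, r \in `[s, t] ->
           derivable (partial j (u r)) x (delta_mx i 0)) /\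
        {within Q, continuous (fun z => partial i (partial j (u z.1)) z.2)}].

(* MathComp-Analysis norms matrices by the maximum of the entries. *)
Definition euclid_norm n (w : 'cV[R]_n) : R := Num.sqrt (\sum_i w i 0 ^+ 2).

End Calculus.

Section Density.
Context {R : realType}.

(* Iterated Lebesgue integral over R^n; by Tonelli it is the integral against
   n-dimensional Lebesgue measure for nonnegative measurable integrands. *)
Fixpoint iter_integral n : (n.-tuple R -> \bar R) -> \bar R :=
  match n with
  | 0 => fun g => g [tuple]
  | m.+1 => fun g =>
      (\int[lebesgue_measure]_y
         iter_integral (fun z : m.-tuple R => g [tuple of y :: z]))%E
  end.

Definition prob_density d (g : 'cV[R]_d -> R) : Prop :=
  [/\ forall x, 0 <= g x,
      measurable_fun [set: d.-tuple (measurableTypeR R)]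
        (fun z : d.-tuple (measurableTypeR R) =>
           g (\col_i tnth z i) : measurableTypeR R) &
      iter_integral (fun z : d.-tuple R => (g (\col_i tnth z i))%:E) = 1%E].

Definition posdef n (S : 'M[R]_n) : Prop :=
  S^T = S /\ forall w : 'cV[R]_n, w != 0 -> 0 < (w^T *m S *m w) 0 0.

Definition gaussian_density n (m : 'cV[R]_n) (S : 'M[R]_n) (o : 'cV[R]_n) : R :=
  (Num.sqrt ((2 * pi) ^+ n * \det S))^-1 *
  expR (- (2^-1 * ((o - m)^T *m invmx S *m (o - m)) 0 0)).

End Density.

Section Filtering.
Context {R : realType} {d d' : nat}.
Variables (mu : 'cV[R]_d -> 'cV[R]_d) (sigma : 'cV[R]_d -> 'M[R]_d).

Definition diffusion (x : 'cV[R]_d) : 'M[R]_d := sigma x *m (sigma x)^T.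

Definition generator (phi : 'cV[R]_d -> R) (x : 'cV[R]_d) : R :=
  2^-1 * (\sum_i \sum_j diffusion x i j * partial i (partial j phi) x)
  + \sum_i mu x i 0 * partial i phi x.

Definition f_filter (x : 'cV[R]_d) (u : R) (w : 'cV[R]_d) : R :=
  (\sum_i \sum_j partial i (fun y => diffusion y i j) x * w j 0)
  + 2^-1 * (\sum_i \sum_j partial i (partial j (fun y => diffusion y i j)) x * u)
  - (\sum_i partial i (fun y => mu y i 0) x * u)
  - 2 * (\sum_i mu x i 0 * w i 0).

Definition f_log (x : 'cV[R]_d) (u : R) (w : 'cV[R]_d) : R :=
  - (2^-1 * euclid_norm ((sigma x)^T *m w) ^+ 2) - f_filter x 1 (- w).

(* The integrated equation at the point (t, x), started at time s.  The first
   two clauses make its right-hand side meaningful: [derive] and [Rintegral]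
   are total functions with default values. *)
Definition evolution_eq (g : 'cV[R]_d -> R -> 'cV[R]_d -> R)
    (u : R -> 'cV[R]_d -> R) (s t : R) (x : 'cV[R]_d) : Prop :=
  let F r := generator (u r) x + g x (u r x) (grad (u r) x) in
  [/\ forall r, r \in `[s, t] -> C2 (u r),
      lebesgue_measure.-integrable `[s, t]%classic (EFin \o F) &
      u t x = u s x + \int[lebesgue_measure]_(r in `[s, t]) F r].

Definition tgrid (T : R) (K k : nat) : R := k%:R * T / K%:R.

(* Times at which the k-th component of a solution is defined. *)
Definition time_dom (T : R) (K k : nat) : set R :=
  if (k < K)%N then `[tgrid T K k, tgrid T K k.+1]%classic else [set T].

(* An observation sequence o_{1:k} is the matrix with columns o_1, ..., o_k. *)
Definition obs_prefix k (o : 'M[R]_(d', k.+1)) : 'M[R]_(d', k) :=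
  colsub (widen_ord (leqnSn k)) o.

Definition obs_last k (o : 'M[R]_(d', k.+1)) : 'cV[R]_d' := col ord_max o.

End Filtering.

(* Main.v *)
Require Import Defs.
From HB Require Import structures.
From mathcomp Require Import all_boot all_order all_algebra.
From mathcomp Require Import all_classical all_reals all_analysis.
From mathcomp Require Import ring lra.

Set Implicit Arguments.
Unset Strict Implicit.
Unset Printing Implicit Defensive.

Import Order.TTheory GRing.Theory Num.Theory.
Import numFieldNormedType.Exports.

Local Open Scope classical_set_scope.
Local Open Scope ring_scope.

(** The substitution [v = - ln p] is the Hopf-Cole transform.  Fix [x] and the
    observations.  The integrand [F] of the filtering equation is continuous in
    time because [p] is of class C^{1,2} ([continuous_generator_f_filter]), so
    the integral equation says that [p] has time derivative [F], and hence
    [- ln p] has time derivative [- F / p]; integrating back gives the integral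
    equation for [v] with integrand [- F / p] ([integral_neg_log]).

    It remains to see that [- F / p] is the integrand of the equation for [v],
    which is the pointwise identity [generator_f_log_neg_ln].  Two facts combine
    there.  By the chain rule, [A v = - A p / p + |sigma^T grad v|^2 / 2]
    ([generator_neg_ln]), and the first term of [f_log] removes the square.  As
    [f] is linear in its last two arguments jointly ([f_filterZ]),
    [f(x, p, grad p) / p = f(x, 1, grad p / p) = f(x, 1, - grad v)], which is
    the other term up to sign.

    The update rule is the logarithm of a product; its second factor, the
    likelihood, is positive as the quotient of two values of [p]. *)

(** * Directional derivatives *)

Section DirectionalDerivative.
Context {R : realType}.

(** A directional derivative only sees the restriction of the function to a
    line, which reduces the chain rule below to functions of one variable. *)
Lemma is_derive_lineP (V : normedModType R) (f : V -> R) (x v : V) (df : R) :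
  is_derive x v f df <-> is_derive (0 : R) 1 (fun h : R => f (h *: v + x)) df.
Proof.
have E : 'D_v f x = 'D_1 (fun h : R => f (h *: v + x)) 0.
  rewrite /derive; set g1 := fun h => h^-1 *: _; set g2 := fun h => h^-1 *: _.
  suff -> : g1 = g2 by [].
  by rewrite funeqE /g1 /g2 => h /=; rewrite addr0 scale0r add0r [_%:A]mulr1.
split=> -[dl vl]; split.
- exact: (derivable1P f x v).1 dl.
- by rewrite -E.
- exact: (derivable1P f x v).2 dl.
- by rewrite E.
Qed.

Lemma is_derive_comp1 (V : normedModType R) (phi : V -> R) (g : R -> R)
    (x v : V) (dphi dg : R) :
  is_derive x v phi dphi -> is_derive (phi x) 1 g dg ->
  is_derive x v (g \o phi) (dg * dphi).
Proof.
move=> /is_derive_lineP dl dgx; apply/is_derive_lineP.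
apply: (@is_derive1_comp R g (fun h : R => phi (h *: v + x))).
by rewrite scale0r add0r.
Qed.

Lemma is_derive_neg_ln (V : normedModType R) (phi : V -> R) (x v : V)
    (dphi : R) :
  0 < phi x -> is_derive x v phi dphi ->
  is_derive x v (fun y => - ln (phi y)) (- (dphi / phi x)).
Proof.
move=> phi_gt0 dphix; rewrite mulrC -mulNr.
apply: (is_derive_comp1 (g := fun r => - ln r)) => //.
exact/is_deriveN/is_derive1_ln.
Qed.

Lemma is_derive_neg_div (V : normedModType R) (f g : V -> R) (x v : V)
    (df dg : R) :
  g x != 0 -> is_derive x v f df -> is_derive x v g dg ->
  is_derive x v (fun y => - (f y / g y))
    (- (df / g x) + f x / g x * (dg / g x)).
Proof.
move=> gx0 dfx dgx.
have dV : is_derive x v (fun y => (g y)^-1) (- (g x ^- 2) * dg).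
  have [dg1 vg] := dgx; split; first exact: derivableV.
  by rewrite deriveV // vg.
have -> : - (df / g x) + f x / g x * (dg / g x) =
    - (f x *: (- (g x ^- 2) * dg) + (g x)^-1 *: df).
  by rewrite /GRing.scale /=; field.
exact: is_deriveN (is_deriveM dfx dV).
Qed.
End DirectionalDerivative.

(** * Limits and continuity *)

Section Limits.
Context {R : realType}.

Lemma cvg_sum (I : Type) (T : Type) (G : set_system T) (FG : Filter G)
    (r : seq I) (f : I -> T -> R) (a : I -> R) :
  (forall i, f i @ G --> a i) ->
  (fun y => \sum_(i <- r) f i y) @ G --> \sum_(i <- r) a i.
Proof. by move=> fa; apply: cvg_big => //; exact: add_continuous. Qed.

(** Joint continuity in time and space is only ever used along a line of fixed
    [x]; this is how it is specialised. *)
Lemma within_slice (V : topologicalType) (s t : R) (g : R * V -> R) (x : V) :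
  {within `[s, t]%classic `*` [set: V], continuous g} ->
  {within `[s, t], continuous (fun r => g (r, x))}.
Proof.
move=> /subspace_continuousP cg; apply/subspace_continuousP => r rst.
apply: cvg_comp (cg (r, x) (conj rst I)) => A nA.
have pair_cvg : (fun q : R => (q, x)) @ nbhs r --> (r, x).
  exact: (cvg_pair (@cvg_id _ (nbhs r)) (@cvg_cst V x _ _ _)).
have : \forall q \near r, (`[s, t]%classic `*` [set: V]) (q, x) -> A (q, x).
  exact: pair_cvg nA.
by apply: filterS => q Aq qst; exact: Aq.
Qed.

Lemma within_continuous_neg_div (f g : R -> R) (A : set R) :
  {within A, continuous f} -> {within A, continuous g} ->
  (forall x, A x -> g x != 0) ->
  {within A, continuous (fun x => - (f x / g x))}.
Proof.
move=> /subspace_continuousP cf /subspace_continuousP cg g0.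
apply/subspace_continuousP => x Ax; apply: cvgN; apply: cvgM; first exact: cf.
by apply: cvgV; [exact: g0|exact: cg].
Qed.
End Limits.

(** * The logarithm of an integral *)

(** The fundamental theorem of calculus makes [P] an antiderivative of [F], so
    [- ln P] is an antiderivative of [- (F / P)]; integrating back gives the
    claim. *)
Lemma integral_neg_log (R : realType) (F P : R -> R) (s t : R) : s <= t ->
  {within `[s, t], continuous F} ->
  (forall r, r \in `[s, t] -> 0 < P r) ->
  (forall r, r \in `[s, t] ->
     P r = P s + \int[lebesgue_measure]_(q in `[s, r]) F q) ->
  lebesgue_measure.-integrable `[s, t] (EFin \o (fun r => - (F r / P r))) /\
  - ln (P t) = - ln (P s) + \int[lebesgue_measure]_(r in `[s, t]) - (F r / P r).
Proof.
move=> st cF P_gt0 PE.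
have intF : lebesgue_measure.-integrable `[s, t] (EFin \o F).
  by apply: continuous_compact_integrable => //; exact: segment_compact.
have cP : {within `[s, t], continuous P}.
  have PE' : {in `[s, t]%classic : set R,
      (fun r => P s + parameterized_integral lebesgue_measure s r F) =1 P}.
    by move=> r; rewrite inE /= => rst; rewrite [RHS]PE.
  apply: (subspace_eq_continuous PE').
  have /subspace_continuousP cI := parameterized_integral_continuous st intF.
  apply/subspace_continuousP => r rst.
  by apply: cvgD; [exact: cvg_cst|exact: cI].
have cG : {within `[s, t], continuous (fun r => - (F r / P r))}.
  by apply: within_continuous_neg_div => // r rst; rewrite gt_eqF ?P_gt0.
split.
  by apply: continuous_compact_integrable => //; exact: segment_compact.
move: st; rewrite le_eqVlt => /predU1P[<-|st].
  by rewrite set_itv1 Rintegral_set1 addr0.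
have cL : {within `[s, t], continuous (fun r => - ln (P r))}.
  move/subspace_continuousP : cP => cP; apply/subspace_continuousP => r rst.
  by apply: cvgN; apply: continuous_cvg; [exact/continuous_ln/P_gt0|exact: cP].
have dL r : r \in `]s, t[ ->
    is_derive r 1 (fun r => - ln (P r)) (- (F r / P r)).
  move=> rst; have rst' : r \in `[s, t] by exact: subset_itv_oo_cc rst.
  apply: is_derive_neg_ln; first exact: P_gt0.
  have [sr rt] : s < r /\ r < t by move: rst; rewrite in_itv /= => /andP[].
  have cFr := within_continuous_continuous st cF rst.
  have [dI vI] := continuous_FTC1_closed rt intF sr cFr.
  (* the integral representation of P holds on the closed interval only, which
     is still a neighbourhood of the interior point r *)
  apply: (@near_eq_is_derive _ _ _
    (fun r => P s + \int[lebesgue_measure]_(q in `[s, r]) F q)).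
    near=> q; rewrite -PE//.
    apply: subset_itv_oo_cc; near: q.
    exact: near_in_itvoo.
  rewrite -[F r]add0r; apply: is_deriveD.
  by split; [exact: dI|rewrite -derive1E].
have [_ cs ct] := (continuous_within_itvP _ st).1 cL.
rewrite /Rintegral (continuous_FTC2 st cG (F := fun r => - ln (P r))) //=.
- by rewrite addrC; lra.
- by split=> // r /dL[].
- by move=> r /dL[_ vr]; rewrite derive1E.
Unshelve. all: by end_near. Qed.

(** * Spatial derivatives of minus the logarithm *)

Section NegLog.
Context {R : realType} {d : nat}.
Implicit Types (phi psi : 'cV[R]_d -> R) (x : 'cV[R]_d).

Lemma is_derive_partial phi x i : derivable phi x (delta_mx i 0) ->
  is_derive x (delta_mx i 0) phi (partial i phi x).
Proof. exact: derivableP. Qed.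

Lemma partial_neg_ln phi i :
  (forall x, derivable phi x (delta_mx i 0)) -> (forall x, 0 < phi x) ->
  partial i (fun y => - ln (phi y)) = fun x => - (partial i phi x / phi x).
Proof.
move=> dphi phi_gt0; apply/funext => x.
by have [] := is_derive_neg_ln (phi_gt0 x) (is_derive_partial (dphi x)).
Qed.

(** The shape of this quotient is that of the first partial derivatives of
    [- ln phi], so the lemma yields the second order part of [C2_neg_ln]. *)
Lemma C1_neg_div phi psi : C1 phi -> C1 psi -> (forall x, 0 < psi x) ->
  C1 (fun x => - (phi x / psi x)).
Proof.
move=> [cf df] [cg dg] g_gt0.
have g0 x : psi x != 0 by rewrite gt_eqF.
have cV x : {for x, continuous (fun y => (psi y)^-1)}.
  exact: continuousV (g0 x) (cg x).
split=> [x|i]; first exact: continuousN (continuousM (cf x) (cV x)).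
have D x : is_derive x (delta_mx i 0) (fun x => - (phi x / psi x))
    (- (partial i phi x / psi x) + phi x / psi x * (partial i psi x / psi x)).
  by apply: is_derive_neg_div => //; apply: is_derive_partial;
    [exact: (df i).1|exact: (dg i).1].
split=> [x|]; first by case: (D x).
have -> : partial i (fun x => - (phi x / psi x)) = fun x =>
    - (partial i phi x / psi x) + phi x / psi x * (partial i psi x / psi x).
  by apply/funext => y; case: (D y).
move=> x.
have c1 := continuousN (continuousM ((df i).2 x) (cV x)).
have c2 := continuousM (continuousM (cf x) (cV x))
  (continuousM ((dg i).2 x) (cV x)).
exact: (continuousD c1 c2).
Qed.

Lemma C2_neg_ln phi : C2 phi -> (forall x, 0 < phi x) ->
  C2 (fun x => - ln (phi x)).
Proof.
move=> [C1phi C1p] phi_gt0; have [cphi dphi] := C1phi.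
have C1q i : C1 (partial i (fun x => - ln (phi x))).
  rewrite partial_neg_ln //; last exact: (dphi i).1.
  exact: C1_neg_div.
split=> //; split=> [x|i].
  exact: continuousN (continuous_comp (cphi x) (continuous_ln (phi_gt0 x))).
split; last exact: (C1q i).1.
move=> x.
by have [] := is_derive_neg_ln (phi_gt0 x) (is_derive_partial ((dphi i).1 x)).
Qed.

(** The last summand is the product of the two first partial derivatives of
    [- ln phi]: this is where the quadratic gradient term comes from. *)
Lemma partial2_neg_ln phi x i j : C2 phi -> (forall y, 0 < phi y) ->
  partial i (partial j (fun y => - ln (phi y))) x =
  - (partial i (partial j phi) x / phi x) +
  partial i phi x / phi x * (partial j phi x / phi x).
Proof.
move=> [[cphi dphi] C1p] phi_gt0.
rewrite (partial_neg_ln (dphi j).1 phi_gt0).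
have phi0 : phi x != 0 by rewrite gt_eqF.
have := is_derive_neg_div phi0 (is_derive_partial (((C1p j).2 i).1 x))
  (is_derive_partial ((dphi i).1 x)).
move=> [_ E]; apply: (eq_trans E).
by rewrite (mulrC (_ / _)).
Qed.

(** * The logarithmic transform of the equation *)

Variables (mu : 'cV[R]_d -> 'cV[R]_d) (sigma : 'cV[R]_d -> 'M[R]_d).

Lemma sqr_euclid_norm_diffusion x (w : 'cV[R]_d) :
  euclid_norm ((sigma x)^T *m w) ^+ 2 =
  \sum_i \sum_j diffusion sigma x i j * (w i 0 * w j 0).
Proof.
rewrite sqr_sqrtr; last by apply: sumr_ge0 => i _; exact: sqr_ge0.
transitivity ((w^T *m (diffusion sigma x *m w)) 0 0).
  rewrite /diffusion -mulmxA mulmxA -[w^T *m _]trmxK trmx_mul trmxK.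
  by rewrite [RHS]mxE; apply: eq_bigr => i _; rewrite [_^T _ _]mxE expr2.
rewrite mxE; apply: eq_bigr => i _; rewrite !mxE mulr_sumr.
by apply: eq_bigr => j _; rewrite mulrCA.
Qed.

(** Every term of [f] is linear in [(u, w)] jointly.  This homogeneity turns
    [f(x, phi, grad phi) / phi] into [f(x, 1, grad phi / phi)], an expression in
    the gradient of [ln phi] alone. *)
Lemma f_filterZ x c u (w : 'cV[R]_d) :
  f_filter mu sigma x (c * u) (c *: w) = c * f_filter mu sigma x u w.
Proof.
rewrite /f_filter !mulrDr !mulrN !(mulrCA c) !mulr_sumr.
congr (_ + _ - _ - _).
- apply: eq_bigr => i _; rewrite mulr_sumr; apply: eq_bigr => j _.
  by rewrite mxE mulrCA.
- apply: eq_bigr => i _; rewrite !mulr_sumr; apply: eq_bigr => j _.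
  by rewrite (mulrCA c) [_ * (c * u)]mulrCA.
- by apply: eq_bigr => i _; rewrite mulrCA.
- by apply: eq_bigr => i _; rewrite mxE (mulrCA c) [_ * (c * _)]mulrCA.
Qed.

(** Second order chain rule: the generator fails to commute with
    [phi |-> - ln phi] exactly by half the squared norm of the gradient,
    weighted by the diffusion matrix. *)
Lemma generator_neg_ln phi x : C2 phi -> (forall y, 0 < phi y) ->
  generator mu sigma (fun y => - ln (phi y)) x =
  - (generator mu sigma phi x / phi x) +
  2^-1 * euclid_norm ((sigma x)^T *m grad (fun y => - ln (phi y)) x) ^+ 2.
Proof.
move=> C2phi phi_gt0; have dphi i := (C2phi.1.2 i).1.
rewrite sqr_euclid_norm_diffusion /generator mulrDl opprD addrAC; congr (_ + _).
  rewrite -mulrA -mulrN -mulrDr; congr (_ * _).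
  rewrite mulr_suml -sumrN -big_split /=; apply: eq_bigr => i _.
  rewrite mulr_suml -sumrN -big_split /=; apply: eq_bigr => j _.
  by rewrite partial2_neg_ln // !mxE !partial_neg_ln //; ring.
rewrite mulr_suml -sumrN; apply: eq_bigr => i _.
by rewrite partial_neg_ln //; ring.
Qed.

(** The quadratic term of [f_log] cancels the one produced by the chain rule;
    homogeneity of [f] takes care of the rest. *)
Lemma generator_f_log_neg_ln phi x u : C2 phi -> (forall y, 0 < phi y) ->
  generator mu sigma (fun y => - ln (phi y)) x
  + f_log mu sigma x u (grad (fun y => - ln (phi y)) x) =
  - ((generator mu sigma phi x + f_filter mu sigma x (phi x) (grad phi x))
     / phi x).
Proof.
move=> C2phi phi_gt0; rewrite generator_neg_ln // /f_log.
have -> : - grad (fun y => - ln (phi y)) x = (phi x)^-1 *: grad phi x.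
  apply/colP => i; rewrite !mxE partial_neg_ln //; last exact: (C2phi.1.2 i).1.
  by rewrite opprK mulrC.
have -> : 1 = (phi x)^-1 * phi x by rewrite mulVf // gt_eqF.
rewrite f_filterZ; ring.
Qed.

(** Makes the fundamental theorem of calculus applicable to the integrand of
    the filtering equation, at a fixed point [x]. *)
Lemma continuous_generator_f_filter (s t : R) (u : R -> 'cV[R]_d -> R) x :
  C12 s t u ->
  {within `[s, t], continuous (fun r =>
     generator mu sigma (u r) x + f_filter mu sigma x (u r x) (grad (u r) x))}.
Proof.
move=> [/(within_slice (x := x))/subspace_continuousP /= c0 _ c1 c2].
have c1' i := (subspace_continuousP _ _).1 (within_slice (x := x) (c1 i).2).
have c2' i j := (subspace_continuousP _ _).1 (within_slice (x := x) (c2 i j).2).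
apply/subspace_continuousP => r rst.
have cst (c : R) : (fun=> c) @ within `[s, t]%classic (nbhs r) --> c.
  exact: cvg_cst.
rewrite /generator /f_filter; apply: cvgD; first apply: cvgD.
- apply: cvgM => //; apply: cvg_sum => i; apply: cvg_sum => j.
  by apply: cvgM => //; exact: c2'.
- by apply: cvg_sum => i; apply: cvgM => //; exact: c1'.
apply: cvgB; first apply: cvgB; first apply: cvgD.
- apply: cvg_sum => i; apply: cvg_sum => j; apply: cvgM => //.
  under eq_fun do rewrite mxE.
  rewrite mxE.
  exact: c1'.
- apply: cvgM => //; apply: cvg_sum => i; apply: cvg_sum => j.
  by apply: cvgM => //; exact: c0.
- by apply: cvg_sum => i; apply: cvgM => //; exact: c0.
- apply: cvgM => //; apply: cvg_sum => i; apply: cvgM => //.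
  under eq_fun do rewrite mxE.
  rewrite mxE.
  exact: c1'.
Qed.

(** The equation for [- ln u] at time [t] draws on the one for [u] at all times
    between [s] and [t], because the latter is differentiated in time. *)
Lemma evolution_neg_ln (s e : R) (u : R -> 'cV[R]_d -> R) (x : 'cV[R]_d) :
  C12 s e u -> (forall r y, r \in `[s, e] -> 0 < u r y) ->
  (forall t, t \in `[s, e] ->
     evolution_eq mu sigma (f_filter mu sigma) u s t x) ->
  forall t, t \in `[s, e] ->
    evolution_eq mu sigma (f_log mu sigma) (fun r y => - ln (u r y)) s t x.
Proof.
move=> C12u u_gt0 u_evol t tse.
have [st te] : s <= t /\ t <= e by move: tse; rewrite in_itv /= => /andP[].
have sub r : r \in `[s, t] -> r \in `[s, e].
  by rewrite !in_itv /= => /andP[-> rt]; exact: le_trans rt te.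
have [C2u _ _] := u_evol t tse.
pose F r := generator mu sigma (u r) x +
  f_filter mu sigma x (u r x) (grad (u r) x).
have cF : {within `[s, t], continuous F}.
  have ste : `[s, t]%classic `<=` `[s, e]%classic by move=> r; exact: sub.
  exact: (continuous_subspaceW ste (continuous_generator_f_filter C12u)).
have [intG GE] := integral_neg_log (P := fun r => u r x) st cF
  (fun r rst => u_gt0 r x (sub r rst))
  (fun r rst => let: And3 _ _ E := u_evol r (sub r rst) in E).
have FE : {in `[s, t]%classic, (fun r => - (F r / u r x)) =1 (fun r =>
    generator mu sigma (fun y => - ln (u r y)) x
    + f_log mu sigma x (- ln (u r x)) (grad (fun y => - ln (u r y)) x))}.
  move=> r; rewrite inE /= => rst; rewrite generator_f_log_neg_ln //.
    exact: C2u.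
  by move=> y; exact/u_gt0/sub.
split=> [r rst||].
- by apply: C2_neg_ln; [exact: C2u|move=> y; exact/u_gt0/sub].
- apply: eq_integrable intG => // r rst /=.
  by rewrite FE.
- by rewrite GE; congr (_ + _); apply: eq_Rintegral => r rst; exact: FE.
Qed.
End NegLog.

Theorem theorem2p1 (R : realType) (d d' K : nat) (T : R)
  (mu : 'cV[R]_d -> 'cV[R]_d) (sigma : 'cV[R]_d -> 'M[R]_d)
  (pi0 : 'cV[R]_d -> R) (h : 'cV[R]_d -> 'cV[R]_d') (Rcov : 'M[R]_d')
  (p : forall k : nat, R -> 'cV[R]_d -> 'M[R]_(d', k) -> R)
  (K_gt0 : (0 < K)%N) (T_gt0 : 0 < T)
  (mu_C1 : forall i, C1 (fun x => mu x i 0))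
  (a_C2 : forall i j, C2 (fun x => diffusion sigma x i j))
  (pi0_gt0 : forall x, 0 < pi0 x) (pi0_density : prob_density pi0)
  (Rcov_posdef : posdef Rcov)
  (p_gt0 : forall k t x o, (k <= K)%N -> time_dom T K k t -> 0 < p k t x o)
  (p_C12 : forall k o, (k < K)%N ->
     C12 (tgrid T K k) (tgrid T K k.+1) (fun t x => p k t x o))
  (p_init : forall x o, p 0%N 0 x o = pi0 x)
  (p_evol : forall k x (o : 'M[R]_(d', k.+1)) t, (k < K)%N ->
     t \in `[tgrid T K k, tgrid T K k.+1] ->
     evolution_eq mu sigma (f_filter mu sigma)
       (fun s y => p k s y (obs_prefix o)) (tgrid T K k) t x)
  (p_update : forall k x (o : 'M[R]_(d', k.+1)), (k < K)%N ->
     p k.+1 (tgrid T K k.+1) x o =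
     p k (tgrid T K k.+1) x (obs_prefix o) *
     gaussian_density (h x) Rcov (obs_last o)) :
  let v (k : nat) (t : R) (x : 'cV[R]_d) (o : 'M[R]_(d', k)) : R :=
    - ln (p k t x o) in
  [/\ forall x o, v 0%N 0 x o = - ln (pi0 x),
      forall k x (o : 'M[R]_(d', k.+1)) t, (k < K)%N ->
        t \in `[tgrid T K k, tgrid T K k.+1] ->
        evolution_eq mu sigma (f_log mu sigma)
          (fun s y => v k s y (obs_prefix o)) (tgrid T K k) t x &
      forall k x (o : 'M[R]_(d', k.+1)), (k < K)%N ->
        v k.+1 (tgrid T K k.+1) x o =
        v k (tgrid T K k.+1) x (obs_prefix o)
        - ln (gaussian_density (h x) Rcov (obs_last o))].
Proof.
have dom k t : (k < K)%N -> t \in `[tgrid T K k, tgrid T K k.+1] ->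
  time_dom T K k t by move=> kK; rewrite /time_dom kK.
have mono k : tgrid T K k <= tgrid T K k.+1.
  by rewrite /tgrid ler_pM2r ?invr_gt0 ?ltr0n // ler_pM2r // ler_nat.
have last k : (k < K)%N -> time_dom T K k.+1 (tgrid T K k.+1).
  (* the last component lives at the single time T, which is its grid time *)
  move=> kK; rewrite /time_dom; case: ifPn => [_|].
    by rewrite /= in_itv /= lexx mono.
  rewrite -leqNgt => Kk; have -> : k.+1 = K by apply/eqP; rewrite eqn_leq kK.
  by rewrite /= /tgrid mulrAC divff ?mul1r // pnatr_eq0 -lt0n.
move=> v; split.
- by move=> x o; rewrite /v p_init.
- move=> k x o t kK tk.
  apply: (evolution_neg_ln (p_C12 k (obs_prefix o) kK)) tk.
    by move=> r y rk; apply: p_gt0; [exact: ltnW|exact: dom].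
  by move=> r rk; exact: p_evol.
- move=> k x o kK.
  have p1 : 0 < p k.+1 (tgrid T K k.+1) x o by apply: p_gt0 => //; exact: last.
  have p0 : 0 < p k (tgrid T K k.+1) x (obs_prefix o).
    apply: p_gt0; first exact: ltnW.
    by apply: dom => //; rewrite in_itv /= lexx mono.
  (* positivity of the likelihood follows from that of p before and after the
     update *)
  move: (p1); rewrite p_update // pmulr_rgt0 // => L_gt0.
  by rewrite /v p_update // lnM // opprD.
Qed.
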